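(* Let $q$ be a prime power, $m,r\ge1$, $V_{m,r}=\{f\in\mathbb{F}_q[x_1,\ldots,x_m]:\deg f\le r\}$, and let $V$ be an $\mathbb{F}_q$-subspace of $V_{m,r}$ that has property $( * )$. Then for every $\mathcal{L},\mathcal{L}'\subseteq V$, $$\left|\sum_{f\in\mathcal{L},f'\in\mathcal{L}'}\operatorname{N}_q(f-f')-q^{m-1}|\mathcal{L}||\mathcal{L}'|\right|\le q^{\dim V-1}\sqrt{|\mathcal{L}||\mathcal{L}'|}.$$
   Context: For $g\in\mathbb{F}_q[x_1,\ldots,x_m]$, $\operatorname{N}_q(g)=|\{\alpha\in\mathbb{F}_q^m:g(\alpha)=0\}|$. A subspace $V$ of $\mathbb{F}_q[x_1,\ldots,x_m]$ has property $( * )$ if $V$ has a basis of monomials $\{x_1^{i_1}\cdots x_m^{i_m}:(i_1,\ldots,i_m)\in\mathcal{I}\}$, where $\mathcal{I}$ is a finite subset of $\mathbb{N}^m$ such that (i) $(0,\ldots,0)\in\mathcal{I}$, and (ii) there exist integers $k_1,\ldots,k_m$ with $(k_1,0,\ldots,0),\ldots,(0,\ldots,0,k_m)\in\mathcal{I}$ and $\gcd(k_i,q-1)=1$ for each $i$.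
   Formalization: In property ( * ) the integers k_i are required to be positive; this matters only for q = 2, where gcd(0, q−1) = 1 would admit k_i = 0 and the bound fails (q = m = 2, V the constants, L = L' = {0} gives 2 ≤ 1). *)

(* Defs.v *)
From mathcomp Require Import all_boot all_order all_algebra.
From mathcomp Require Import finmap.
From mathcomp Require Export mpoly.

Set Implicit Arguments.
Unset Strict Implicit.
Unset Printing Implicit Defensive.

Import GRing.Theory.
Local Open Scope ring_scope.

(* {mpoly F[m]} is infinite dimensional, hence not a vectType; bases and
   dimensions of its subspaces are therefore stated for predicates on an
   arbitrary lmodType. *)
Section Bases.
Variables (F : fieldType) (W : lmodType F).
Implicit Types (V : {pred W}) (s : seq W).

Definition lin_indep s : Prop :=
  forall c : 'I_(size s) -> F, \sum_i c i *: s`_i = 0 -> forall i, c i = 0.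

Definition spans V s : Prop :=
  forall v, v \in V -> exists c : 'I_(size s) -> F, v = \sum_i c i *: s`_i.

Definition is_basis V s : Prop :=
  [/\ {subset s <= V}, lin_indep s & spans V s].

Definition has_dim V (d : nat) : Prop :=
  exists2 s, is_basis V s & size s = d.

End Bases.

Section Polynomials.
Variables (F : finFieldType) (m : nat).
Implicit Types (V : {pred {mpoly F[m]}}) (g : {mpoly F[m]}).

Definition Nq g : nat := #|[set a : {ffun 'I_m -> F} | g.@[a] == 0]|.

(* msize g is 1 + deg g, and 0 if g = 0. *)
Definition deg_le (r : nat) : {pred {mpoly F[m]}} :=
  [pred g | (msize g <= r.+1)%N].

(* The condition 0 < k i follows from gcd (k i, q - 1) = 1 unless q = 2, where
   gcd (0, 1) = 1. There it has to be required: with q = m = 2 and V the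
   constants, k = (0, 0) would be admissible, and for L = L' = {0} the bound of
   the theorem would read |4 - 2| <= 1. *)
Definition property_star V : Prop :=
  exists I : {fset 'X_{1..m}},
    [/\ is_basis V [seq 'X_[e] | e <- enum_fset I],
        0%MM \in I
      & exists k : 'I_m -> nat, forall i : 'I_m,
          [/\ (0 < k i)%N, (U_(i) *+ k i)%MM \in I
            & coprime (k i) (#|F| - 1)]].

End Polynomials.

(* Main.v *)
(** Write [q = #|F|]. The evaluations of a uniformly chosen [f] in [V] at the
    points of [F^m] are uniform, because [V] contains [1], and pairwise
    independent, because [x_i^k_i] lies in [V] and separates any two points
    that differ in the [i]-th coordinate: raising to the power [k_i] is a
    bijection of [F]. For [A] in [V], let
    [w_A(x,t) = #|{f in A : f(x) = t}| - #|A| / q]. The quantity to be bounded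
    is [sum_(x,t) w_L(x,t) w_L'(x,t)], so by Cauchy-Schwarz it suffices that
    [S = sum_(x,t) w_A(x,t)^2 <= lambda #|A|] with [lambda = #|V| / q]. Put
    [y(f) = sum_x w_A(x, f(x))]. Pairwise independence and
    [sum_t w_A(x,t) = 0] give [|y|^2 = lambda S], while [<y, 1_A> = S]; now
    expand [0 <= |y - lambda 1_A|^2 = lambda (lambda #|A| - S)]. *)

From HB Require Import structures.
Require Import Defs.
From mathcomp Require Import all_boot all_order all_algebra all_field.
From mathcomp Require Import finmap mpoly.
From mathcomp Require Import ring.

Set Implicit Arguments.
Unset Strict Implicit.
Unset Printing Implicit Defensive.

Import Order.TTheory GRing.Theory Num.Theory.
Local Open Scope ring_scope.

(** * Cauchy-Schwarz and summation along fibres *)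

Lemma sum_cauchy_schwarz (R : realFieldType) (I : finType) (a b : I -> R) :
  (\sum_i a i * b i) ^+ 2 <= (\sum_i a i ^+ 2) * (\sum_i b i ^+ 2).
Proof.
set C := \sum_i _; set P := \sum_i a i ^+ 2; set Q := \sum_i b i ^+ 2.
have Q_ge0 : 0 <= Q by apply: sumr_ge0 => i _; exact: sqr_ge0.
have [Q0|Q_neq0] := eqVneq Q 0.
  have b0 i : b i = 0.
    apply/eqP; rewrite -sqrf_eq0; apply/eqP.
    by apply: (psumr_eq0P _ Q0) => // j _; exact: sqr_ge0.
  have -> : C = 0 by apply: big1 => i _; rewrite b0 mulr0.
  by rewrite Q0 mulr0 expr0n.
(* The vector with entries [Q * a i - C * b i] is [Q] times the component of [a] orthogonal to
   [b]. *)
have : 0 <= \sum_i (Q * a i - C * b i) ^+ 2.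
  by apply: sumr_ge0 => i _; exact: sqr_ge0.
have -> : \sum_i (Q * a i - C * b i) ^+ 2 = Q * (P * Q - C ^+ 2).
  have expand x y : \sum_i (x * a i - y * b i) ^+ 2
      = x ^+ 2 * P - 2 * x * y * C + y ^+ 2 * Q.
    rewrite /C /P /Q !mulr_sumr -sumrB -big_split /=.
    by apply: eq_bigr => i _; ring.
  by rewrite expand; ring.
by rewrite pmulr_rge0 ?subr_ge0 // lt0r Q_neq0.
Qed.

Lemma sum_fibres (R : pzRingType) (T K : finType) (A : {pred T}) (k : T -> K)
    (G : K -> R) :
  \sum_(c in A) G (k c) = \sum_t #|[set c in A | k c == t]|%:R * G t.
Proof.
rewrite (partition_big k xpredT) //=; apply: eq_bigr => t _.
rewrite (eq_bigr (fun=> G t)); last by move=> c /andP[_ /eqP->].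
rewrite sumr_const mulr_natl; congr (_ *+ _).
by apply: eq_card => c; rewrite !inE.
Qed.

(** * Mixing bound for a pairwise independent family of maps *)

Section PairwiseIndependence.

Variables (R : rcfType) (X T K : finType) (h : X -> T -> K).

Hypothesis K_gt0 : (0 < #|K|)%N.
Hypothesis uniform : forall x t, (#|[set c | h x c == t]| * #|K| = #|T|)%N.
Hypothesis independent : forall x y t s, x != y ->
  (#|[set c | (h x c, h y c) == (t, s)]| * (#|K| * #|K|) = #|T|)%N.

Let q : R := #|K|%:R.
(** By [uniform], this is the size of every fibre of every [h x]; by [independent], joint fibres at
    two points have size [lambda / q]. *)
Let lambda : R := #|T|%:R / q.

Definition discrepancy (A : {set T}) (x : X) (t : K) : R :=
  #|[set c in A | h x c == t]|%:R - #|A|%:R / q.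

Let q_neq0 : q != 0. Proof. by rewrite pnatr_eq0 -lt0n. Qed.

Lemma sum_card_fibres (A : {set T}) x :
  \sum_t #|[set c in A | h x c == t]|%:R = #|A|%:R :> R.
Proof.
have := sum_fibres (mem A) (h x) (fun=> 1 : R).
by rewrite sumr_const => ->; apply: eq_bigr => t _; rewrite mulr1.
Qed.

Lemma sum_discrepancy A x : \sum_t discrepancy A x t = 0.
Proof.
rewrite sumrB sum_card_fibres sumr_const -[X in _ - X]mulr_natr.
by rewrite mulfVK ?subrr.
Qed.

Lemma sum_uniform x (G : K -> R) :
  \sum_c G (h x c) = lambda * \sum_t G t.
Proof.
have := sum_fibres predT (h x) G => ->.
rewrite mulr_sumr; apply: eq_bigr => t _; congr (_ * _).
by rewrite /lambda -(uniform x t) natrM mulfK.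
Qed.

Lemma sum_independent x y (G H : K -> R) : x != y ->
  \sum_c G (h x c) * H (h y c) = lambda / q * (\sum_t G t) * (\sum_s H s).
Proof.
move=> xy.
have := sum_fibres predT (fun c => (h x c, h y c)) (fun u => G u.1 * H u.2).
move=> /= ->; rewrite (eq_bigr (fun u => lambda / q * (G u.1 * H u.2))).
  rewrite -(pair_bigA _ (fun t s => lambda / q * (G t * H s))) /=.
  rewrite -mulrA mulr_suml mulr_sumr; apply: eq_bigr => t _.
  by rewrite !mulr_sumr.
move=> [t s] _; congr (_ * _).
by rewrite /lambda -(independent t s xy) 2!natrM mulrA !mulfK.
Qed.

Lemma discrepancy_energy (A : {set T}) :
  \sum_x \sum_t discrepancy A x t ^+ 2 <= lambda * #|A|%:R.
Proof.
pose w := discrepancy A; pose y c := \sum_x w x (h x c).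
set S := \sum_x _.
have y_norm : \sum_c y c ^+ 2 = lambda * S.
  under eq_bigr => c _ do rewrite expr2 /y mulr_suml.
  rewrite exchange_big mulr_sumr; apply: eq_bigr => x _ /=.
  under eq_bigr => c _ do rewrite mulr_sumr.
  (* Off the diagonal the sum over [c] factors, and both factors vanish by [sum_discrepancy]. *)
  rewrite exchange_big (bigD1 x) //= [X in _ + X]big1 ?addr0.
    rewrite -(sum_uniform x (fun t => w x t ^+ 2)).
    by apply: eq_bigr => c _; rewrite expr2.
  move=> z zx; rewrite sum_independent 1?eq_sym // sum_discrepancy.
  by rewrite mulr0 mul0r.
have y_A : \sum_(c in A) y c = S.
  rewrite exchange_big; apply: eq_bigr => x _ /=.
  rewrite (sum_fibres (mem A) (h x) (w x)).
  (* Centring only one factor suffices: the constant [#|A| / q] is paired with a sum equal to 0. *)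
  under [RHS]eq_bigr => t _ do rewrite expr2 {1}/discrepancy mulrBl.
  by rewrite sumrB -mulr_sumr sum_discrepancy mulr0 subr0.
have lambda_ge0 : 0 <= lambda by rewrite divr_ge0 ?ler0n.
have := @sumr_ge0 R T (index_enum T) xpredT
  (fun c => (y c - lambda *+ (c \in A)) ^+ 2) (fun c _ => sqr_ge0 _).
have -> : \sum_c (y c - lambda *+ (c \in A)) ^+ 2
    = lambda * (lambda * #|A|%:R - S).
  transitivity (lambda * S - 2 * lambda * S + lambda ^+ 2 * #|A|%:R);
    last by ring.
  rewrite -{2}y_A -y_norm -sumr_const.
  rewrite !mulr_sumr [X in _ - X]big_mkcond [X in _ + X]big_mkcond -sumrB.
  rewrite -big_split /=; apply: eq_bigr => c _.
  by case: (c \in A); rewrite ?mulr1n ?mulr0n; ring.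
(* A positive [lambda] cancels. If [lambda = 0], then [T] is empty and [y_A] gives [S = 0]. *)
have [l0 _|l_neq0] := eqVneq lambda 0; last first.
  by rewrite pmulr_rge0 ?subr_ge0 // lt0r l_neq0.
have T0 : #|T| = 0%N.
  by apply/eqP; rewrite -(pnatr_eq0 R) -(divfK q_neq0 #|T|%:R) -/lambda l0 mul0r.
by rewrite l0 mul0r -y_A big1 // => c; have := card0_eq T0 c; rewrite inE.
Qed.

(** For fixed [x], agreeing pairs are counted by the products of the fibre sizes of [A] and [B] over
    each [t]; centring both factors subtracts exactly [#|A| * #|B| / q]. *)
Lemma sum_agreements (A B : {set T}) :
  (\sum_(a in A) \sum_(b in B) #|[set x | h x a == h x b]|)%N%:R
    - #|X|%:R / q * #|A|%:R * #|B|%:R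
  = \sum_x \sum_t discrepancy A x t * discrepancy B x t.
Proof.
have -> : (\sum_(a in A) \sum_(b in B) #|[set x | h x a == h x b]|)%N%:R
    = \sum_x \sum_(a in A) #|[set b in B | h x b == h x a]|%:R :> R.
  rewrite natr_sum exchange_big; apply: eq_bigr => a _ /=.
  rewrite -!natr_sum; congr _%:R.
  under eq_bigr => b _ do rewrite -sum1dep_card.
  rewrite (exchange_big_dep xpredT) //=; apply: eq_bigr => x _.
  by rewrite -sum1dep_card; apply: eq_bigl => b; rewrite eq_sym.
have -> : #|X|%:R / q * #|A|%:R * #|B|%:R
    = \sum_(x : X) #|A|%:R * #|B|%:R / q.
  by rewrite sumr_const -[RHS]mulr_natl; ring.
rewrite -sumrB; apply: eq_bigr => x _.
rewrite (sum_fibres (mem A) (h x) (fun t => #|[set b in B | h x b == t]|%:R)).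
under [RHS]eq_bigr => t _ do rewrite {1}/discrepancy mulrBl.
rewrite sumrB -mulr_sumr sum_discrepancy mulr0 subr0.
under [RHS]eq_bigr => t _ do rewrite /discrepancy mulrBr.
by rewrite sumrB -mulr_suml sum_card_fibres mulrA.
Qed.

Lemma agreement_mixing (A B : {set T}) :
  `| (\sum_(a in A) \sum_(b in B) #|[set x | h x a == h x b]|)%N%:R
     - #|X|%:R / q * #|A|%:R * #|B|%:R |
  <= lambda * Num.sqrt (#|A|%:R * #|B|%:R).
Proof.
have lambda_ge0 : 0 <= lambda by rewrite divr_ge0 ?ler0n.
(* Both sides become square roots, so that Cauchy-Schwarz over the pairs [(x, t)] applies to the
   squares. *)
rewrite sum_agreements pair_bigA -sqrtr_sqr.
rewrite -{1}[lambda]ger0_norm // -sqrtr_sqr -sqrtrM ?sqr_ge0 //.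
apply: ler_wsqrtr; apply: le_trans (sum_cauchy_schwarz _ _) _.
rewrite -(pair_bigA _ (fun x t => discrepancy A x t ^+ 2)).
rewrite -(pair_bigA _ (fun x t => discrepancy B x t ^+ 2)) /=.
rewrite expr2 mulrACA; apply: ler_pM; try exact: discrepancy_energy.
  by do 2![apply: sumr_ge0 => ? _]; exact: sqr_ge0.
by do 2![apply: sumr_ge0 => ? _]; exact: sqr_ge0.
Qed.

End PairwiseIndependence.

(** * Fibres of additive maps and injectivity of power maps *)

HB.instance Definition _ (U W : finZmodType) := Finite.on (U * W)%type.

(** Translation by a preimage of [t - w] carries the fibre over [w] onto the fibre over [t], so all
    [#|W|] fibres have the same size. *)
Lemma card_fibre_morph (U W : finZmodType) (phi : U -> W) (t : W) :
  {morph phi : x y / x + y} -> (forall w, exists c, phi c = w) ->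
  (#|[set c : U | phi c == t]| * #|W| = #|U|)%N.
Proof.
move=> phiD phi_surj.
have eq_fibre w : #|[set c | phi c == w]| = #|[set c | phi c == t]|.
  have [c0 c0E] := phi_surj (t - w).
  rewrite -(card_imset [set c | phi c == w] (addIr c0)).
  apply: eq_card => c; rewrite !inE.
  apply/imsetP/eqP => [[b]|ct].
    by rewrite inE => /eqP bw ->; rewrite phiD bw c0E addrC subrK.
  exists (c - c0); last by rewrite subrK.
  rewrite inE; apply/eqP/(addIr (t - w)).
  by rewrite -{1}c0E -phiD subrK ct addrC subrK.
rewrite -[RHS]sum1_card (partition_big phi xpredT) //=.
rewrite mulnC -sum_nat_const; apply: eq_bigr => w _.
by rewrite sum1dep_card eq_fibre.
Qed.

(** Bezout gives [u * k = v * (#|F| - 1) + 1], so the power [u] undoes the power [k]. Reducing the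
    exponent through [z ^+ #|F| = z] covers [z = 0] as well. *)
Lemma expf_coprime_inj (F : finFieldType) (k : nat) :
  (0 < k)%N -> coprime k (#|F| - 1) -> injective (fun x : F => x ^+ k).
Proof.
move=> k_gt0; case: (egcdnP (#|F| - 1) k_gt0) => u v uv _ /eqP gcd1 x y /= xy.
have q_gt0 : (0 < #|F|)%N by apply/card_gt0P; exists 0.
have expf_bezout (z : F) : z ^+ k ^+ u = z.
  rewrite -exprM mulnC uv gcd1.
  elim: v {uv} => [|v IHv]; first by rewrite mul0n expr1.
  by rewrite mulSn -addnA exprD IHv -exprSr subn1 prednK // expf_card.
by rewrite -(expf_bezout x) xy expf_bezout.
Qed.

(** * Evaluation at one and at two points *)

Section Evaluation.

Variables (F : finFieldType) (m : nat) (V : {pred {mpoly F[m]}}).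

Hypothesis V_subspace : GRing.submod_closed V.
Hypothesis V_star : property_star V.

Let scale_in_V c f : f \in V -> c *: f \in V.
Proof.
by case: V_subspace => V0 VD fV; have := VD c _ _ fV V0; rewrite addr0.
Qed.

Let one_in_V : 1 \in V.
Proof.
have [I [[sV _ _] I0 _]] := V_star.
by rewrite -mpolyX0; apply: sV; apply: map_f.
Qed.

Lemma eval_surj (a : 'I_m -> F) (t : F) : exists2 f, f \in V & f.@[a] = t.
Proof.
by exists (t *: 1); [exact: scale_in_V | rewrite mevalZ meval1 mulr1].
Qed.

Lemma eval_pair_surj (a b : {ffun 'I_m -> F}) (t s : F) : a != b ->
  exists2 f, f \in V & (f.@[a], f.@[b]) = (t, s).
Proof.
move=> ab.
have [i ab_i] : exists i, a i != b i.
  apply/existsP; apply: contraNT ab; rewrite negb_exists => /forallP eq_ab.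
  by apply/eqP/ffunP => i; apply/eqP; have := eq_ab i; rewrite negbK.
have [I [[sV _ _] _ [k kP]]] := V_star; have [k_gt0 kI k_coprime] := kP i.
pose g : {mpoly F[m]} := 'X_[U_(i) *+ k i].
have gV : g \in V by apply: sV; apply: map_f.
have evalg (c : 'I_m -> F) : g.@[c] = c i ^+ k i.
  by rewrite /g -mpolyXn rmorphXn /= mevalXU.
have g_sep : g.@[a] - g.@[b] != 0.
  by rewrite subr_eq0 !evalg (inj_eq (expf_coprime_inj k_gt0 k_coprime)).
(* Linear interpolation in [g]: [l] is the slope of the line through [(g(a), t)] and [(g(b), s)]. *)
pose l := (t - s) / (g.@[a] - g.@[b]).
exists (l *: g + (t - l * g.@[a]) *: 1).
  by case: V_subspace => _; apply; rewrite ?scale_in_V.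
rewrite !mevalD !mevalZ !meval1 !mulr1; congr (_, _).
  by rewrite addrC subrK.
transitivity (t - l * (g.@[a] - g.@[b])); first by ring.
by rewrite divfK // subKr.
Qed.

End Evaluation.

(** * Transfer from sets of polynomials to sets of coordinate vectors *)

Lemma big_fset_parametrized (T : finType) (U : choiceType) (p : T -> U)
    (L : {fset U}) (G : U -> nat) :
  injective p -> (forall f, f \in L -> exists c, f = p c) ->
  (\sum_(f <- L) G f = \sum_(c in [set c | p c \in L]) G (p c))%N.
Proof.
move=> p_inj p_onto.
rewrite -[RHS]big_enum -(big_map p xpredT G); apply: perm_big.
apply: uniq_perm; rewrite ?fset_uniq ?map_inj_uniq ?enum_uniq // => f.
apply/idP/mapP => [fL|[c]]; last by rewrite mem_enum inE => cL ->.
by have [c fE] := p_onto f fL; exists c; rewrite // mem_enum inE -fE.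
Qed.

Theorem theorem1p7 (R : rcfType) (F : finFieldType) (m r : nat)
    (m_ge1 : (1 <= m)%N) (r_ge1 : (1 <= r)%N)
    (V : {pred {mpoly F[m]}}) (V_subspace : GRing.submod_closed V)
    (V_deg : {subset V <= @deg_le F m r}) (V_star : property_star V)
    (d : nat) (dimV : has_dim V d)
    (L L' : {fset {mpoly F[m]}})
    (L_sub : {subset L <= V}) (L'_sub : {subset L' <= V}) :
  `| (\sum_(f <- L) \sum_(f' <- L') Nq (f - f')%R)%N%:R
     - #|F|%:R ^+ (m - 1) * #|` L|%:R * #|` L'|%:R |
  <= #|F|%:R ^+ (d - 1) * Num.sqrt (#|` L|%:R * #|` L'|%:R) :> R.
Proof.
case: dimV => s [sV s_indep s_spans] <- {d}.
(* Coordinates in the basis [s] replace [V] by a finite additive group, in which counting makes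
   sense. *)
pose d := size s; pose T : finZmodType := 'rV[F]_d.
pose p (c : T) : {mpoly F[m]} := \sum_(i < d) c 0 i *: s`_i.
have pD : {morph p : x y / x + y}.
  by move=> x y; rewrite -big_split; apply: eq_bigr => i _; rewrite mxE scalerDl.
have p_inj : injective p.
  move=> x y xy; apply/rowP => i; apply/eqP; rewrite -subr_eq0; apply/eqP.
  move: i; apply: s_indep; under eq_bigr => i _ do rewrite scalerBl.
  by rewrite sumrB -/(p x) xy subrr.
have p_onto f : f \in V -> exists c, f = p c.
  case/s_spans => c ->; exists (\row_i c i).
  by apply: eq_bigr => i _; rewrite mxE.
pose h (a : {ffun 'I_m -> F}) (c : T) := (p c).@[a].
have hD a : {morph h a : x y / x + y} by move=> x y; rewrite /h pD mevalD.
have q_gt0 : (0 < #|F|)%N by apply/card_gt0P; exists 0.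
have q_neq0 : #|F|%:R != 0 :> R by rewrite pnatr_eq0 -lt0n.
have h_uniform a t : (#|[set c | h a c == t]| * #|F| = #|T|)%N.
  apply: card_fibre_morph => // w.
  by have [f /p_onto[c ->] <-] := eval_surj V_subspace V_star a w; exists c.
have h_independent a b t u : a != b ->
    (#|[set c | (h a c, h b c) == (t, u)]| * (#|F| * #|F|) = #|T|)%N.
  (* The two evaluations form a single additive map into [F * F], onto by interpolation. *)
  move=> ab; rewrite -card_prod.
  apply: (@card_fibre_morph T (F * F)%type (fun c => (h a c, h b c))).
    by move=> x y; rewrite !hD.
  move=> [w w'].
  have [f /p_onto[c ->] <-] := eval_pair_surj V_subspace V_star w w' ab.
  by exists c.
(* Positivity is needed because [d - 1] is a truncated subtraction. With [d = 0] only the zero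
   polynomial would remain, and it never takes the value 1. *)
have d_gt0 : (0 < d)%N.
  rewrite lt0n; apply/eqP => d0.
  have [f /p_onto[c ->]] := eval_surj V_subspace V_star (fun=> 0) 1.
  rewrite /p big1 => [|[i i_lt] _]; last by exfalso; move: i_lt; rewrite d0.
  by rewrite meval0 => /eqP; rewrite eq_sym oner_eq0.
pose A := [set c | p c \in L]; pose B := [set c | p c \in L'].
have L_onto f : f \in L -> exists c, f = p c by move/L_sub/p_onto.
have L'_onto f : f \in L' -> exists c, f = p c by move/L'_sub/p_onto.
have cardA : #|` L| = #|A|.
  by rewrite -sum1_size (big_fset_parametrized _ p_inj) // sum1_card.
have cardB : #|` L'| = #|B|.
  by rewrite -sum1_size (big_fset_parametrized _ p_inj) // sum1_card.
have -> : (\sum_(f <- L) \sum_(f' <- L') Nq (f - f')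
    = \sum_(a in A) \sum_(b in B) #|[set x | h x a == h x b]|)%N.
  rewrite (big_fset_parametrized _ p_inj) //; apply: eq_bigr => a _.
  rewrite (big_fset_parametrized _ p_inj) //; apply: eq_bigr => b _.
  by apply: eq_card => x; rewrite !inE mevalB subr_eq0.
have divq n : (0 < n)%N -> (#|F| ^ n)%:R / #|F|%:R = #|F|%:R ^+ (n - 1) :> R.
  by case: n => // n _; rewrite expnSr natrM mulfK // natrX subn1.
(* Here [#|X| / q] is [q ^ m / q] and [lambda] is [q ^ d / q]. *)
have := agreement_mixing R q_gt0 h_uniform h_independent A B.
by rewrite cardA cardB card_ffun card_mx card_ord mul1n !divq.
Qed.
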